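(* Let $(X,d)$ be a metric space with $|X|\geq 3$ and let $T:X\to X$ be a mapping contracting triangles on $X$. Then $T$ is continuous.
   Context: Let $\Phi$ be the set of all functions $\varphi:[0,\infty)^3\to[0,\infty)$ satisfying: (1) $\varphi$ is symmetric, i.e. $\varphi(a,b,c)$ is invariant under all permutations of its three arguments, for all $a,b,c\in[0,\infty)$; (2) $\varphi$ is continuous; (3) $\varphi$ is non-decreasing (in each of its arguments); (4) there exists $k>0$ such that $ka\leq\varphi(a,b,c)$ for every $a,b,c\in[0,\infty)$; (5) $\varphi(a,b,c)=0$ if and only if $a=b=c=0$. Let $(X,d)$ be a metric space with $|X|\geq 3$. A map $T:X\to X$ is called a mapping contracting triangles on $X$ if there exist $\alpha\in[0,1)$ and $\varphi\in\Phi$ such that $$\varphi(d(Tx,Ty),d(Ty,Tz),d(Tz,Tx))\leq\alpha\,\varphi(d(x,y),d(y,z),d(x,z))$$ holds for all three pairwise distinct points $x,y,z\in X$. *)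

(* Defs.v *)
From HB Require Import structures.
From mathcomp Require Import all_boot all_order all_algebra.
From mathcomp Require Import all_classical all_reals all_analysis.

Set Implicit Arguments.
Unset Strict Implicit.
Unset Printing Implicit Defensive.

Import Order.TTheory GRing.Theory Num.Theory.
Import numFieldNormedType.Exports.

Local Open Scope classical_set_scope.
Local Open Scope ring_scope.

Definition nonneg_octant (R : realType) : set (R * R * R) :=
  [set p | [/\ 0 <= p.1.1, 0 <= p.1.2 & 0 <= p.2]].

(* A function [0, oo[^3 -> [0, oo[ is encoded as a curried total function on R;
   every condition constrains it on the octant only, so that its values
   elsewhere are irrelevant. *)
Record Phi (R : realType) (phi : R -> R -> R -> R) : Prop := {
  Phi_ge0 : forall a b c, 0 <= a -> 0 <= b -> 0 <= c -> 0 <= phi a b c;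
  Phi_sym : forall a b c, 0 <= a -> 0 <= b -> 0 <= c ->
    [/\ phi a c b = phi a b c, phi b a c = phi a b c, phi b c a = phi a b c,
        phi c a b = phi a b c & phi c b a = phi a b c];
  Phi_continuous : {within @nonneg_octant R,
    continuous (fun p : R * R * R => phi p.1.1 p.1.2 p.2)};
  Phi_nondecreasing : forall a b c t, 0 <= a -> 0 <= b -> 0 <= c ->
    [/\ a <= t -> phi a b c <= phi t b c,
        b <= t -> phi a b c <= phi a t c &
        c <= t -> phi a b c <= phi a b t];
  Phi_lower_bound : exists2 k : R, 0 < k &
    forall a b c, 0 <= a -> 0 <= b -> 0 <= c -> k * a <= phi a b c;
  Phi_eq0 : forall a b c, 0 <= a -> 0 <= b -> 0 <= c ->
    phi a b c = 0 <-> [/\ a = 0, b = 0 & c = 0]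
}.

Definition contracting_triangles (R : realType) (X : metricType R)
    (T : X -> X) : Prop :=
  exists (alpha : R) (phi : R -> R -> R -> R),
    [/\ 0 <= alpha < 1, Phi phi &
      forall x y z : X, x != y -> y != z -> x != z ->
        phi (mdist (T x) (T y)) (mdist (T y) (T z)) (mdist (T z) (T x))
          <= alpha * phi (mdist x y) (mdist y z) (mdist x z)].

(* Main.v *)
Require Import Defs.
From mathcomp Require Import all_boot all_order all_algebra.
From mathcomp Require Import all_classical all_reals all_analysis.
From mathcomp Require Import lra.

Import Order.TTheory GRing.Theory Num.Theory.
Import numFieldNormedType.Exports.

Local Open Scope classical_set_scope.
Local Open Scope ring_scope.
Local Open Scope card_scope.

(** Continuity at an isolated point is automatic. At an accumulation point [x],
    a point [y] close to [x] is completed to a triangle [x], [y], [z] by a third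
    point [z], also close to [x]. All three sides are then small, so
    [phi (d x y) (d y z) (d x z)] is small, because [phi] is continuous and
    vanishes at the origin ([Phi_small]). By contraction [phi] is also small on
    the image triangle, and the lower bound [k * a <= phi a b c] turns this into
    smallness of [d (T x) (T y)] ([contracting_triangles_dist_small]). *)

Lemma Phi_small {R : realType} {phi : R -> R -> R -> R} {e : R} :
  Phi phi -> 0 < e ->
  exists2 d : R, 0 < d & forall a b c, 0 <= a < d -> 0 <= b < d -> 0 <= c < d ->
    phi a b c < e.
Proof.
move=> Hphi e0.
have phi0 : phi 0 0 0 = 0 by apply/(Phi_eq0 Hphi).
have oct0 : @nonneg_octant R (0, 0, 0) by split.
have /subspace_continuousP/(_ _ oct0) := Phi_continuous Hphi.
move=> /cvgrPdist_lt/(_ _ e0); rewrite near_withinE /=.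
move=> /nbhs_ballP[d /= d0 dP]; exists d => // a b c.
move=> /andP[a0 ad] /andP[b0 bd] /andP[c0 cd].
have /dP/(_ _) : ball ((0, 0, 0) : R * R * R) d (a, b, c).
  by do !split; rewrite /= /ball /= sub0r normrN ger0_norm.
rewrite /from_subspace /= phi0 sub0r normrN => /(_ _)/(le_lt_trans (ler_norm _)); apply.
by split.
Qed.

(** The estimate needs a genuine triangle: a third point [z], distinct from [x]
    and [y], has to be supplied even though it is absent from the conclusion. *)
Lemma contracting_triangles_dist_small {R : realType} {X : metricType R}
    {T : X -> X} {e : R} :
  contracting_triangles T -> 0 < e ->
  exists2 d : R, 0 < d & forall x y z : X, x != y -> y != z -> x != z ->
    mdist x y < d -> mdist y z < d -> mdist x z < d -> mdist (T x) (T y) < e.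
Proof.
move=> [alpha [phi [/andP[_ alpha1] Hphi HT]]] e0.
have [k k0 kphi] := Phi_lower_bound Hphi.
have [d d0 dphi] := Phi_small Hphi (mulr_gt0 k0 e0).
exists d => // x y z xy yz xz dxy dyz dxz.
rewrite -(ltr_pM2l k0).
apply: le_lt_trans (kphi _ _ _ (mdist_ge0 _ _) (mdist_ge0 (T y) (T z))
  (mdist_ge0 (T z) (T x))) _.
apply: le_lt_trans (HT _ _ _ xy yz xz) _.
have small : phi (mdist x y) (mdist y z) (mdist x z) < k * e.
  by apply: dphi; rewrite mdist_ge0.
apply: le_lt_trans small.
by rewrite ler_piMl ?(ltW alpha1)// (Phi_ge0 Hphi) ?mdist_ge0.
Qed.

Theorem proposition2p1 (R : realType) (X : metricType R) (T : X -> X)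
    (hX : `I_3 #<= [set: X]) (hT : contracting_triangles T) :
  continuous T.
Proof.
move=> x; apply/cvg_ballP => e e0; rewrite ballEmdist /=.
have [d d0 dP] := contracting_triangles_dist_small hT e0.
have d20 : 0 < d / 2 by lra.
have [[z xz dxz]|isolated] := pselect (exists2 z, x != z & mdist x z < d / 2).
  (* The radius [mdist x z] keeps [y] distinct from [z]. *)
  apply/nbhs_ballP; exists (mdist x z) => /=; first by rewrite mdist_gt0.
  move=> y; rewrite ballEmdist /= => dxy.
  have [<-|xy] := eqVneq x y; first by rewrite mdistxx.
  have yz : y != z by apply: contraTneq dxy => ->; rewrite ltxx.
  have dyz := metric_triangle y x z; rewrite (metric_sym y x) in dyz.
  by apply: (dP x y z) => //; lra.
apply/nbhs_ballP; exists (d / 2) => //= y; rewrite ballEmdist /= => dxy.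
have [<-|xy] := eqVneq x y; first by rewrite mdistxx.
by case: isolated; exists y.
Qed.
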